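(* Let $\Sigma: x^+=Ax+Bu+Ew$ be a discrete-time linear system with $A$ nilpotent of nilpotency index $\nu$, and let the safe set $S_{xu}\subset\mathbb{R}^n\times\mathbb{R}^m$ and the disturbance set $W\subset\mathbb{R}^d$ be polytopes. Assume that $0\in W$ and that the interior of $\overline{S}_{xu}$ contains a fixed point $(x,u)$ of $\overline{\Sigma}$, i.e. a point with $Ax+Bu=x$. Then there exist matrices $H$ and $P$ such that $\pi_n(\mathcal{C}_{xv})$ approaches $\mathcal{C}_{outer,\nu}$. Specifically, if $H$ and $P$ are the $(\tau,\lambda)$-lasso matrices, then as $\tau$ increases $\pi_n(\mathcal{C}_{xv,(\tau,\lambda)})$ converges to $\mathcal{C}_{outer,\nu}$ in Hausdorff distance exponentially fast: for every $\lambda\in\mathbb{N}$ there exist $c>0$, $a\in(0,1)$ and $\tau_0\in\mathbb{N}$ such that $$d\big(\pi_n(\mathcal{C}_{xv,(\tau,\lambda)}),\,\mathcal{C}_{outer,\nu}\big)\le c\,a^{\tau}\quad\text{for all integers }\tau\ge\tau_0 .$$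
   Context: Setting: $x\in\mathbb{R}^n$, $u\in\mathbb{R}^m$, $w\in W$; $A\in\mathbb{R}^{n\times n}$, $B\in\mathbb{R}^{n\times m}$, $E\in\mathbb{R}^{n\times d}$. $\nu$ is the smallest positive integer with $A^\nu=0$. A polytope is a bounded set of the form $\{z\mid Gz\le f\}$. Sums of sets are Minkowski sums; $Q-P=\{z\mid z+p\in Q\ \forall p\in P\}$. $\pi_n$ is the projection onto the first $n$ coordinates; $d$ is the Hausdorff distance induced by the Euclidean norm. $\overline{W}_t=\sum_{i=1}^tA^{i-1}EW$ (with $\overline{W}_0=\{0\}$) and $\overline{W}_\infty=\sum_{i=1}^{\nu}A^{i-1}EW$. Reachable set: $\mathcal{R}_\Sigma(x,\{u_i\}_{i=0}^{t-1})=A^tx+\sum_{i=1}^tA^{i-1}Bu_{t-i}+\overline{W}_t$, with $\mathcal{R}_\Sigma(x,\emptyset)=\{x\}$. For a set $R\subseteq\mathbb{R}^n$ and $u\in\mathbb{R}^m$, $(R,u)$ denotes $R\times\{u\}$. Nominal system and safe set: $\overline{\Sigma}: x^+=Ax+Bu$ and $\overline{S}_{xu}=S_{xu}-\overline{W}_\infty\times\{0\}$. A controlled invariant set (CIS) of $\overline{\Sigma}$ within $\overline{S}_{xu}$ is a set $\mathcal{C}$ such that for every $x\in\mathcal{C}$ there is $u$ with $(x,u)\in\overline{S}_{xu}$ and $Ax+Bu\in\mathcal{C}$; $\overline{\mathcal{C}}_{\max}$ is the maximal (largest) such set. Define $$\mathcal{C}_{outer,\nu}=\Big\{x\in\mathbb{R}^n\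 \Big|\ \exists\{u_i\}_{i=0}^{\nu-1}\in\mathbb{R}^{m\nu}:\ (\mathcal{R}_\Sigma(x,\{u_i\}_{i=0}^{t-1}),u_t)\subseteq S_{xu},\ t=0,\dots,\nu-1,\ \ \mathcal{R}_\Sigma(x,\{u_i\}_{i=0}^{\nu-1})\subseteq\overline{\mathcal{C}}_{\max}+\overline{W}_\infty\Big\}.$$ $(\tau,\lambda)$-lasso matrices: for $\tau\in\mathbb{N}\cup\{0\}$, $\lambda\in\mathbb{N}$, $q=\tau+\lambda$, let $P=\mathrm{blkdiag}(\bar P,\dots,\bar P)\in\mathbb{R}^{mq\times mq}$ and $H=\mathrm{blkdiag}(\bar H,\dots,\bar H)\in\mathbb{R}^{m\times mq}$, with $m$ blocks each, where $\bar H=[1\ 0\ \cdots\ 0]\in\mathbb{R}^{1\times q}$ and $\bar P\in\mathbb{R}^{q\times q}$ has first $q-1$ rows $[\,0\ \ I_{q-1}]$ and last row with a single entry $1$ at position $\tau+1$ (positions counted from 1) and zeros elsewhere. Implicit RCIS: for given $P,H$, $\mathcal{C}_{xv}$ is the set of $(x,v)\in\mathbb{R}^n\times\mathbb{R}^{mq}$ such that the inputs $u_t=HP^tv$ satisfy $(\mathcal{R}_\Sigma(x,\{u_i\}_{i=0}^{t-1}),u_t)\subseteq S_{xu}$ for all $t\ge0$ (equivalently, the maximal robust positively invariant set of the companion system $x^+=Ax+BHv+Ew$, $v^+=Pv$, within $\{(x,v)\mid(x,Hv)\in S_{xu}\}$). For the $(\tau,\lambda)$-lasso matrices it is denoted $\mathcal{C}_{xv,(\tau,\lambda)}$.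 *)

(* Defs.v *)
From HB Require Import structures.
From mathcomp Require Import all_boot all_order all_algebra.
From mathcomp Require Import all_classical all_reals all_analysis.

Set Implicit Arguments.
Unset Strict Implicit.
Unset Printing Implicit Defensive.

Import Order.TTheory GRing.Theory Num.Theory.
Import numFieldNormedType.Exports.

Local Open Scope classical_set_scope.
Local Open Scope ring_scope.

(* A point (x, u) of R^n x R^m is the stacked column vector
   col_mx x u : 'cV_(n + m), so subsets of R^n x R^m are sets of such
   vectors. *)

(* The library norm on matrices is the sup norm; boundedness and the
   interior do not depend on the choice of norm, but the Hausdorff distance
   below does and uses [enorm]. *)
Definition polytope (R : realType) (k : nat) (S : set 'cV[R]_k) : Prop :=
  bounded_set S /\
  exists (p : nat) (G : 'M[R]_(p, k)) (f : 'cV[R]_p),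
    S = [set z | forall i, (G *m z) i 0 <= f i 0].

Definition enorm (R : realType) (k : nat) (x : 'cV[R]_k) : R :=
  Num.sqrt (\sum_i x i 0 ^+ 2).

(* Hausdorff distance with values in the extended reals: it is +oo when
   exactly one of the sets is empty.  (When both are empty it is -oo instead
   of the customary 0.) *)
Definition hausdorff_excess (R : realType) (k : nat) (P Q : set 'cV[R]_k) :
    \bar R :=
  ereal_sup [set ereal_inf [set (enorm (x - y))%:E | y in Q] | x in P].

Definition hausdorff_dist (R : realType) (k : nat) (P Q : set 'cV[R]_k) :
    \bar R :=
  Order.max (hausdorff_excess P Q) (hausdorff_excess Q P).

Definition mink_sum (R : realType) (k : nat) (P Q : set 'cV[R]_k) :
    set 'cV[R]_k :=
  [set x + y | x in P & y in Q].

Definition mink_diff (R : realType) (k : nat) (Q P : set 'cV[R]_k) :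
    set 'cV[R]_k :=
  [set z | forall p, P p -> Q (z + p)].

Definition pair_set (R : realType) (n m : nat) (X : set 'cV[R]_n)
    (u : 'cV[R]_m) : set 'cV[R]_(n + m) :=
  [set col_mx x u | x in X].

Definition proj_fst (R : realType) (n p : nat) (C : set 'cV[R]_(n + p)) :
    set 'cV[R]_n :=
  [set usubmx z | z in C].

Definition nilpotency_index (R : realType) (n : nat) (A : 'M[R]_n)
    (nu : nat) : Prop :=
  [/\ (0 < nu)%N, A ^+ nu = 0 &
      forall k, (0 < k)%N -> A ^+ k = 0 -> (nu <= k)%N].

(* Wbar A E W t is the set \overline{W}_t; \overline{W}_oo is Wbar A E W nu,
   with nu the nilpotency index of A. *)
Definition Wbar (R : realType) (n d : nat) (A : 'M[R]_n) (E : 'M[R]_(n, d))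
    (W : set 'cV[R]_d) (t : nat) : set 'cV[R]_n :=
  \big[@mink_sum R n/[set 0]]_(1 <= i < t.+1)
    [set A ^+ i.-1 *m (E *m w) | w in W].

(* Finite input sequences are given as functions on nat: reach _ _ _ _ t x u
   depends only on u 0, ..., u (t - 1). *)
Definition reach (R : realType) (n m d : nat) (A : 'M[R]_n)
    (B : 'M[R]_(n, m)) (E : 'M[R]_(n, d)) (W : set 'cV[R]_d)
    (t : nat) (x : 'cV[R]_n) (u : nat -> 'cV[R]_m) : set 'cV[R]_n :=
  mink_sum
    [set A ^+ t *m x + \sum_(1 <= i < t.+1) A ^+ i.-1 *m (B *m u (t - i)%N)]
    (Wbar A E W t).

Definition Sbar (R : realType) (n m d : nat) (A : 'M[R]_n)
    (E : 'M[R]_(n, d)) (W : set 'cV[R]_d) (Sxu : set 'cV[R]_(n + m))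
    (nu : nat) : set 'cV[R]_(n + m) :=
  mink_diff Sxu (pair_set (Wbar A E W nu) 0).

Definition is_CIS (R : realType) (n m : nat) (A : 'M[R]_n)
    (B : 'M[R]_(n, m)) (S : set 'cV[R]_(n + m)) (C : set 'cV[R]_n) : Prop :=
  forall x, C x -> exists u : 'cV[R]_m, S (col_mx x u) /\ C (A *m x + B *m u).

(* The largest controlled invariant set of x^+ = A x + B u within S, obtained
   as the union of all of them; see CISmax_is_CIS and CISmax_largest. *)
Definition CISmax (R : realType) (n m : nat) (A : 'M[R]_n)
    (B : 'M[R]_(n, m)) (S : set 'cV[R]_(n + m)) : set 'cV[R]_n :=
  \bigcup_(C in is_CIS A B S) C.

Lemma CISmax_is_CIS (R : realType) (n m : nat) (A : 'M[R]_n)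
    (B : 'M[R]_(n, m)) (S : set 'cV[R]_(n + m)) :
  is_CIS A B S (CISmax A B S).
Proof.
move=> x [C CC Cx]; have [u [Su Cu]] := CC _ Cx.
by exists u; split=> //; exists C.
Qed.

Lemma CISmax_largest (R : realType) (n m : nat) (A : 'M[R]_n)
    (B : 'M[R]_(n, m)) (S : set 'cV[R]_(n + m)) (C : set 'cV[R]_n) :
  is_CIS A B S C -> C `<=` CISmax A B S.
Proof. by move=> CC x Cx; exists C. Qed.

Definition C_outer (R : realType) (n m d : nat) (A : 'M[R]_n)
    (B : 'M[R]_(n, m)) (E : 'M[R]_(n, d)) (W : set 'cV[R]_d)
    (Sxu : set 'cV[R]_(n + m)) (nu : nat) : set 'cV[R]_n :=
  [set x | exists u : nat -> 'cV[R]_m,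
    (forall t, (t < nu)%N ->
       pair_set (reach A B E W t x u) (u t) `<=` Sxu) /\
    reach A B E W nu x u `<=`
      mink_sum (CISmax A B (Sbar A E W Sxu nu)) (Wbar A E W nu)].

Definition C_xv (R : realType) (n m d p : nat) (A : 'M[R]_n)
    (B : 'M[R]_(n, m)) (E : 'M[R]_(n, d)) (W : set 'cV[R]_d)
    (Sxu : set 'cV[R]_(n + m)) (H : 'M[R]_(m, p)) (P : 'M[R]_p) :
    set 'cV[R]_(n + p) :=
  [set z | let u t := H *m (P ^+ t *m dsubmx z) in
    forall t, pair_set (reach A B E W t (usubmx z) u) (u t) `<=` Sxu].

(* Indices count from 0: the last row has its 1 in column tau. *)
Definition lasso_Pbar (R : realType) (tau lambda : nat) :
    'M[R]_(tau + lambda) :=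
  \matrix_(i, j) (if i.+1 == (tau + lambda)%N then (j == tau :> nat)%:R
                  else (j == i.+1 :> nat)%:R).

Definition lasso_Hbar (R : realType) (tau lambda : nat) :
    'rV[R]_(tau + lambda) :=
  \row_j (j == 0%N :> nat)%:R.

(* The dimension m q appears as \sum_(i < m) q, the library's dimension for
   block matrices with m blocks of size q. *)
Definition lasso_P (R : realType) (m tau lambda : nat) :
    'M[R]_(\sum_(i < m) (tau + lambda)) :=
  \mxdiag_(i < m) lasso_Pbar R tau lambda.

(* blkdiag(Hbar, ..., Hbar): its i-th block column, of size m x q, has Hbar as
   row i and zeros elsewhere. *)
Definition lasso_H (R : realType) (m tau lambda : nat) :
    'M[R]_(m, \sum_(i < m) (tau + lambda)) :=
  \mxrow_(i < m) (delta_mx i (0 : 'I_1) *m lasso_Hbar R tau lambda).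

(* Main.v *)
Require Import Defs.
From HB Require Import structures.
From mathcomp Require Import all_boot all_order all_algebra.
From mathcomp Require Import all_classical all_reals all_analysis.
From mathcomp Require Import zify ring lra.

Set Implicit Arguments.
Unset Strict Implicit.
Unset Printing Implicit Defensive.

Import Order.TTheory GRing.Theory Num.Theory.
Import numFieldNormedType.Exports.

Local Open Scope classical_set_scope.
Local Open Scope ring_scope.

(** Write [Winf] for [Wbar A E W nu] and call nominal the trajectories of the
    system without disturbance.  The reachable set at time [t] is the nominal
    state plus [Wbar A E W t], and [Wbar A E W t] increases with [t] and is
    equal to [Winf] from [nu] on, because [A] is nilpotent and [0] is in [W].

    The projection of [C_xv] is contained in [C_outer] whatever [H] and [P]
    are: along a safe input sequence the nominal states at the times [t >= nu]
    form a controlled invariant set ([safe_in_C_outer]).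

    Conversely, let [x] be in [C_outer].  Its nominal state [y] at time [nu]
    satisfies [y + Winf <= CISmax + Winf]; cancelling the bounded set [Winf]
    puts [y] in the closure of the convex set [CISmax]
    ([mink_sum_cancel_closure]).  Hence [x] has an infinite input sequence [u]
    whose nominal states are as close as wanted to states [c] such that
    [(c t + w, u t)] is safe for all [w] in [Wbar A E W t]
    ([C_outer_continuation]).

    This sequence has to become periodic after time [tau].  Let [(xf, uf)] be
    the fixed point, the center of a ball of radius [eps] in [Sbar].  Pull the
    input toward [uf], with weight [beta t = rho ^ (tau - t)] for [t <= tau] and
    [1] afterwards: [u' t = (1 - beta t) u t + beta t uf], and start from
    [x' = (1 - beta 0) x + beta 0 xf].  If [beta] were constant in time, the new
    state would be the same convex combination of the nominal state of [x] and
    [xf].  The error made by letting [beta] vary is driven by its increments;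
    these are at most [(1 - rho) beta t] up to time [t], and a nilpotent
    recurrence has bounded gain, so the error is at most a constant times
    [(1 - rho) beta t].  Convexity of the safe set leaves a margin [beta t eps]
    around the convex combination.  Error and margin are both proportional to
    [beta t], so a single [rho < 1] makes [u'] safe at all times, for all [tau]
    ([blend_safe]).  Finally [x - x' = rho ^ tau (x - xf)] with [x] bounded,
    which is the exponential rate, and [u'] is the constant [uf] from [tau] on,
    so that the lasso matrices generate it for every [lambda]
    ([lasso_realizes]). *)

(** * Norms *)

Lemma mx_norm_entry (R : realType) (p k : nat) (M : 'M[R]_(p, k)) i j :
  `|M i j| <= `|M|.
Proof.
rewrite [leRHS]/Num.Def.normr /= mx_normrE.
by apply/bigmax_geP; right; exists (i, j).
Qed.

Lemma mx_norm_le (R : realType) (p k : nat) (M : 'M[R]_(p, k)) (b : R) :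
  0 <= b -> (forall i j, `|M i j| <= b) -> `|M| <= b.
Proof.
move=> b0 Mb; rewrite [leLHS]/Num.Def.normr /= mx_normrE.
by apply: bigmax_le => // -[i j] _; exact: Mb.
Qed.

Lemma mx_norm_mul (R : realType) (p k l : nat) (M : 'M[R]_(p, k))
    (N : 'M[R]_(k, l)) :
  `|M *m N| <= k%:R * `|M| * `|N|.
Proof.
apply: mx_norm_le => [|i j]; first by rewrite !mulr_ge0.
rewrite mxE (le_trans (ler_norm_sum _ _ _))//.
rewrite (@le_trans _ _ (\sum_(s < k) `|M| * `|N|))//.
  by apply: ler_sum => s _; rewrite normrM ler_pM// mx_norm_entry.
by rewrite sumr_const card_ord -[leLHS]mulr_natl mulrA.
Qed.

Lemma enormZ (R : realType) (k : nat) (a : R) (z : 'cV[R]_k) :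
  0 <= a -> enorm (a *: z) = a * enorm z.
Proof.
move=> a0; rewrite /enorm.
under eq_bigr do rewrite mxE exprMn.
by rewrite -mulr_sumr sqrtrM ?sqr_ge0// sqrtr_sqr ger0_norm.
Qed.

Lemma enorm_le (R : realType) (k : nat) (z : 'cV[R]_k) :
  enorm z <= Num.sqrt k%:R * `|z|.
Proof.
rewrite -[`|z|]normr_id -sqrtr_sqr -sqrtrM ?ler0n// ler_wsqrtr//.
rewrite mulr_natl -[k in _ *+ k]card_ord -sumr_const.
by apply: ler_sum => i _; rewrite -[leLHS]real_normK ?num_real// lerXn2r
  ?nnegrE// mx_norm_entry.
Qed.

Lemma bounded_setP (R : realType) (k : nat) (S : set 'cV[R]_k) :
  bounded_set S <-> exists b : R, forall z, S z -> `|z| <= b.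
Proof.
split=> [[b [_ Sb]]|[b Sb]]; first by exists (b + 1) => z; apply: Sb; lra.
exists b; split; first exact: num_real.
by move=> c bc z Sz; rewrite /= (le_trans (Sb _ Sz))// ltW.
Qed.

(** * Minkowski sums and the disturbance sets *)

Lemma mink_sumA (R : realType) (k : nat) : associative (@mink_sum R k).
Proof.
move=> X Y Z; apply/seteqP; split=> z /=.
  move=> [x Xx [_ [y Yy [w Zw <-]] <-]].
  by exists (x + y); [exists x => //; exists y|exists w; rewrite ?addrA].
move=> [_ [x Xx [y Yy <-]] [w Zw <-]].
by exists x => //; exists (y + w); [exists y => //; exists w|rewrite addrA].
Qed.

Lemma mink_sum0l (R : realType) (k : nat) : left_id [set 0] (@mink_sum R k).
Proof.
move=> X; apply/seteqP; split=> z /=.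
  by move=> [_ -> [x Xx <-]]; rewrite add0r.
by move=> Xz; exists 0 => //; exists z; rewrite ?add0r.
Qed.

Lemma mink_sum0r (R : realType) (k : nat) : right_id [set 0] (@mink_sum R k).
Proof.
move=> X; apply/seteqP; split=> z /=.
  by move=> [x Xx [_ -> <-]]; rewrite addr0.
by move=> Xz; exists z => //; exists 0; rewrite ?addr0.
Qed.

HB.instance Definition _ (R : realType) (k : nat) :=
  Monoid.isLaw.Build (set 'cV[R]_k) [set 0] (@mink_sum R k)
    (@mink_sumA R k) (@mink_sum0l R k) (@mink_sum0r R k).

Lemma Wbar0 (R : realType) (n d : nat) (A : 'M[R]_n) (E : 'M[R]_(n, d))
    (W : set 'cV[R]_d) :
  Wbar A E W 0 = [set 0].
Proof. by rewrite /Wbar big_geq. Qed.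

Lemma WbarS (R : realType) (n d : nat) (A : 'M[R]_n) (E : 'M[R]_(n, d))
    (W : set 'cV[R]_d) (t : nat) :
  Wbar A E W t.+1 =
  mink_sum (Wbar A E W t) [set A ^+ t *m (E *m w) | w in W].
Proof. by rewrite /Wbar big_nat_recr. Qed.

Lemma Wbar_zero (R : realType) (n d : nat) (A : 'M[R]_n) (E : 'M[R]_(n, d))
    (W : set 'cV[R]_d) (t : nat) :
  W 0 -> Wbar A E W t 0.
Proof.
move=> W0; elim: t => [|t IH]; first by rewrite Wbar0.
rewrite WbarS; exists 0 => //; exists 0; last by rewrite addr0.
by exists 0; rewrite ?mulmx0.
Qed.

Lemma Wbar_bounded (R : realType) (n d : nat) (A : 'M[R]_n)
    (E : 'M[R]_(n, d)) (W : set 'cV[R]_d) (t : nat) :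
  bounded_set W -> bounded_set (Wbar A E W t).
Proof.
move=> /bounded_setP[b Wb]; apply/bounded_setP; elim: t => [|t [c Wc]].
  by exists 0 => z; rewrite Wbar0 => ->; rewrite normr0.
exists (c + n%:R * `|A ^+ t : 'M[R]_n| * (d%:R * `|E| * b)) => z.
rewrite WbarS => -[x Wx [_ [w Ww <-] <-]].
rewrite (le_trans (ler_normD _ _))// lerD ?Wc//.
rewrite (le_trans (mx_norm_mul _ _))// ler_wpM2l ?mulr_ge0//.
by rewrite (le_trans (mx_norm_mul _ _))// ler_wpM2l ?mulr_ge0// Wb.
Qed.

(** * Nilpotent matrices *)

Section Nilpotent.
Variables (R : realType) (n : nat) (A : 'M[R]_n) (nu : nat).
Hypothesis A_nilp : A ^+ nu = 0.

Lemma nilp_expr_eq0 k : (nu <= k)%N -> A ^+ k = 0.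
Proof. by move=> nuk; rewrite -(subnKC nuk) exprD A_nilp mul0r. Qed.

Lemma Wbar_stable (d : nat) (E : 'M[R]_(n, d)) (W : set 'cV[R]_d) (t : nat) :
  W 0 -> (nu <= t)%N -> Wbar A E W t = Wbar A E W nu.
Proof.
move=> W0; elim: t => [|t IH]; first by rewrite leqn0 => /eqP->.
rewrite leq_eqVlt => /predU1P[->//|nut].
rewrite WbarS (nilp_expr_eq0 nut) -[RHS]mink_sum0r IH//; congr mink_sum.
apply/seteqP; split=> z /=; first by move=> [w _ <-]; rewrite mul0mx.
by move=> ->; exists 0; rewrite ?mul0mx.
Qed.

Lemma Wbar_sub (d : nat) (E : 'M[R]_(n, d)) (W : set 'cV[R]_d) (t : nat) :
  W 0 -> Wbar A E W t `<=` Wbar A E W nu.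
Proof.
move=> W0; have incr s k : Wbar A E W s `<=` Wbar A E W (k + s).
  elim: k => // k IH z /IH Wz; rewrite addSn WbarS.
  by exists z => //; exists 0; [exists 0; rewrite ?mulmx0|rewrite addr0].
case: (leqP nu t) => [nut|/ltnW tnu]; first by rewrite Wbar_stable.
by rewrite -(subnK tnu); exact: incr.
Qed.

(** A bound on the sum of the operator norms of all powers of [A]; the factor
    [n] passes from the entrywise norm to the operator norm.  It controls a
    single power as well as the response to a bounded forcing term. *)
Definition nilp_gain : R := \sum_(k < nu) n%:R * `|A ^+ k : 'M[R]_n|.

Lemma nilp_gain_ge0 : 0 <= nilp_gain.
Proof. by apply: sumr_ge0 => k _; rewrite mulr_ge0. Qed.

Lemma sum_expr_le_gain t :
  \sum_(k < t) n%:R * `|A ^+ k : 'M[R]_n| <= nilp_gain.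
Proof.
pose f k := n%:R * `|A ^+ k : 'M[R]_n|.
have f0 k : 0 <= f k by rewrite mulr_ge0.
rewrite /nilp_gain -!(big_mkord predT f).
case: (leqP nu t) => [nut|/ltnW tnu].
  rewrite (big_cat_nat (leq0n _) nut)/= gerDl big_nat_cond big1// => k.
  by move=> /andP[/andP[nuk _] _]; rewrite /f nilp_expr_eq0// normr0 mulr0.
by rewrite [leRHS](big_cat_nat (leq0n _) tnu)//= lerDl sumr_ge0.
Qed.

Lemma norm_expr_le_gain k (z : 'cV[R]_n) : `|A ^+ k *m z| <= nilp_gain * `|z|.
Proof.
rewrite (le_trans (mx_norm_mul _ _))// ler_wpM2r//.
apply: le_trans (sum_expr_le_gain k.+1); rewrite big_ord_recr /= lerDr.
by apply: sumr_ge0 => i _; rewrite mulr_ge0.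
Qed.

(** Unrolled, [r t] is the sum over [k < t] of [A ^+ k *m e (t - 1 - k)], and
    only the powers [k < nu] contribute; this is why the bound does not grow
    with [t]. *)
Lemma nilp_recurrence_le (r e : nat -> 'cV[R]_n) (b : R) t :
  r 0%N = 0 -> (forall s, r s.+1 = A *m r s + e s) ->
  0 <= b -> (forall s, (s < t)%N -> `|e s| <= b) -> `|r t| <= nilp_gain * b.
Proof.
move=> r0 rS b0 eb.
have -> : r t = \sum_(k < t) A ^+ k *m e (t.-1 - k)%N.
  elim: t {eb} => [|t IH]; first by rewrite big_ord0.
  rewrite rS IH big_ord_recl /= expr0 mul1mx subn0 addrC; congr (_ + _).
  rewrite mulmx_sumr; apply: eq_bigr => k _.
  by rewrite mulmxA -[A *m _]/(A * _) -exprS; congr (_ *m e _); rewrite /bump /=; lia.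
rewrite (le_trans (ler_norm_sum _ _ _))//.
apply: le_trans (ler_wpM2r b0 (sum_expr_le_gain t)).
rewrite mulr_suml; apply: ler_sum => k _.
rewrite (le_trans (mx_norm_mul _ _))// ler_wpM2l ?mulr_ge0// eb//.
by have := ltn_ord k; lia.
Qed.

End Nilpotent.

(** * Nominal trajectories *)

Fixpoint traj (R : realType) (n m : nat) (A : 'M[R]_n) (B : 'M[R]_(n, m))
    (x : 'cV[R]_n) (u : nat -> 'cV[R]_m) (t : nat) : 'cV[R]_n :=
  if t is s.+1 then A *m traj A B x u s + B *m u s else x.

Section Dynamics.
Variables (R : realType) (n m : nat) (A : 'M[R]_n) (B : 'M[R]_(n, m)).
Implicit Types (x : 'cV[R]_n) (u : nat -> 'cV[R]_m).

Lemma traj_sum x u t :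
  traj A B x u t =
  A ^+ t *m x + \sum_(1 <= i < t.+1) A ^+ i.-1 *m (B *m u (t - i)%N).
Proof.
elim: t => [|t IH] /=; first by rewrite big_geq// addr0 expr0 mul1mx.
rewrite IH mulmxDr mulmxA -[A *m _]/(A * _) -exprS -addrA; congr (_ + _).
rewrite [RHS]big_ltn// expr0 mul1mx subn1 addrC; congr (_ + _).
rewrite mulmx_sumr [RHS]big_add1 /=; apply: eq_big_nat => i /andP[i0 _].
by rewrite mulmxA -[A *m _]/(A * _) -exprS subSS prednK.
Qed.

Lemma traj_ext x u v t :
  (forall s, (s < t)%N -> u s = v s) -> traj A B x u t = traj A B x v t.
Proof.
elim: t => //= t IH uv; rewrite uv// IH// => s st.
by rewrite uv// ltnW.
Qed.

Variables (d : nat) (E : 'M[R]_(n, d)) (W : set 'cV[R]_d).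
Variable (S : set 'cV[R]_(n + m)).

Lemma pair_reach_subP t x u (v : 'cV[R]_m) :
  pair_set (reach A B E W t x u) v `<=` S <->
  forall w, Wbar A E W t w -> S (col_mx (traj A B x u t + w) v).
Proof.
rewrite /reach -traj_sum; split=> [RS w Ww|WS _ [_ [_ -> [w Ww <-]] <-]].
  by apply: RS; exists (traj A B x u t + w) => //; exists (traj A B x u t) => //;
    exists w.
exact: WS.
Qed.

Lemma SbarP nu x (v : 'cV[R]_m) :
  Sbar A E W S nu (col_mx x v) <->
  forall w, Wbar A E W nu w -> S (col_mx (x + w) v).
Proof.
split=> [Sx w Ww|Sx _ [w Ww <-]]; last by rewrite add_col_mx addr0; exact: Sx.
by rewrite -[v]addr0 -add_col_mx; apply: Sx; exists w.
Qed.

Lemma CIS_traj (T : set 'cV[R]_(n + m)) (C : set 'cV[R]_n) x :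
  is_CIS A B T C -> C x ->
  exists u, forall t, T (col_mx (traj A B x u t) (u t)).
Proof.
move=> CC Cx.
have /choice[f fC] : forall z, exists v,
    C z -> T (col_mx z v) /\ C (A *m z + B *m v).
  by move=> z; have [/CC[v vP]|nCz] := pselect (C z); [exists v|exists 0].
pose s t := iter t (fun z => A *m z + B *m f z) x.
have sE t : traj A B x (f \o s) t = s t by elim: t => //= t ->.
have Cs t : C (s t) by elim: t => //= t /fC[].
by exists (f \o s) => t; rewrite sE; have [] := fC _ (Cs t).
Qed.

Lemma traj_tail_CIS nu x u :
  (forall t, (nu <= t)%N -> S (col_mx (traj A B x u t) (u t))) ->
  is_CIS A B S [set traj A B x u t | t in [set t | (nu <= t)%N]].
Proof.
move=> Su _ [t /= nut <-]; exists (u t); split; first exact: Su.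
by exists t.+1 => //=; rewrite ltnW.
Qed.

End Dynamics.

(** * Convexity and cancellation of Minkowski sums *)

Lemma convex_setP (R : realType) (k : nat) (S : set 'cV[R]_k) :
  convex_set (S : set (convex_lmodType 'cV[R]_k)) <->
  forall (a : R) x y, 0 <= a -> a <= 1 -> S x -> S y ->
    S (a *: x + (1 - a) *: y).
Proof.
split=> [Sconv a x y a0 a1 Sx Sy|Sconv x y a].
  have := Sconv x y (Itv01 a0 a1); rewrite !inE; exact.
by rewrite !inE; exact: Sconv.
Qed.

Lemma polytope_convex (R : realType) (k : nat) (S : set 'cV[R]_k) :
  polytope S -> convex_set (S : set (convex_lmodType 'cV[R]_k)).
Proof.
move=> [_ [p [G [f ->]]]]; apply/convex_setP => a x y a0 a1 /= Sx Sy i.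
rewrite mulmxDr -!scalemxAr !mxE.
move: (Sx i) (Sy i); rewrite !mxE; nra.
Qed.

Lemma mink_diff_convex (R : realType) (k : nat) (Q P : set 'cV[R]_k) :
  convex_set (Q : set (convex_lmodType 'cV[R]_k)) ->
  convex_set (mink_diff Q P : set (convex_lmodType 'cV[R]_k)).
Proof.
move=> /convex_setP Qc; apply/convex_setP => a x y a0 a1 Qx Qy p Pp.
have -> : a *: x + (1 - a) *: y + p = a *: (x + p) + (1 - a) *: (y + p).
  have Ep : p = a *: p + (1 - a) *: p by rewrite -scalerDl addrC subrK scale1r.
  by rewrite [in LHS]Ep !scalerDr addrACA.
by apply: Qc => //; [exact: Qx|exact: Qy].
Qed.

(** The convex combinations with fixed weight of two points of [CISmax] form a
    controlled invariant set: combine the inputs with the same weight. *)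
Lemma CISmax_convex (R : realType) (n m : nat) (A : 'M[R]_n)
    (B : 'M[R]_(n, m)) (S : set 'cV[R]_(n + m)) :
  convex_set (S : set (convex_lmodType 'cV[R]_(n + m))) ->
  convex_set (CISmax A B S : set (convex_lmodType 'cV[R]_n)).
Proof.
move=> /convex_setP Sc; apply/convex_setP => a x y a0 a1 Cx Cy.
pose C := CISmax A B S.
apply: (@CISmax_largest _ _ _ _ _ _
  [set z | exists x y, [/\ C x, C y & z = a *: x + (1 - a) *: y]]);
  last by exists x, y.
move=> _ [{Cx}x [{Cy}y [Cx Cy ->]]].
have [u [Su Cu]] := CISmax_is_CIS Cx.
have [v [Sv Cv]] := CISmax_is_CIS Cy.
exists (a *: u + (1 - a) *: v); split.
  by rewrite -add_col_mx -!scale_col_mx; exact: Sc.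
exists (A *m x + B *m u), (A *m y + B *m v); split=> //.
by rewrite !mulmxDr -!scalemxAr !scalerDr addrACA.
Qed.

(** Starting from [p0] in [P], write [y + p0 = c0 + p1], [y + p1 = c1 + p2] and
    so on.  Summing [i] of these equations, [y] differs from the mean of the
    [c]'s, a point of [C], by [(pi - p0) / i], which tends to [0] because [P] is
    bounded. *)
Lemma mink_sum_cancel_closure (R : realType) (k : nat)
    (C P : set 'cV[R]_k) (y p0 : 'cV[R]_k) (eps : R) :
  convex_set (C : set (convex_lmodType 'cV[R]_k)) -> bounded_set P -> P p0 ->
  mink_sum [set y] P `<=` mink_sum C P -> 0 < eps ->
  exists2 c, C c & `|y - c| <= eps.
Proof.
move=> /convex_setP Cc /bounded_setP[b Pb] Pp0 yPC eps0.
have step p : P p -> exists c p', [/\ C c, P p' & y + p = c + p'].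
  move=> Pp; have [|c Cc' [p' Pp' <-]] := yPC (y + p); last by exists c, p'.
  by exists y => //; exists p.
have avg i : exists c p, [/\ C c, P p &
    i.+1%:R *: y + p0 = i.+1%:R *: c + p].
  elim: i => [|i [c [p [Cc' Pp yc]]]].
    by have [c [p [? ? ?]]] := step _ Pp0; exists c, p; rewrite !scale1r.
  have [c' [p' [Cc'' Pp' yc']]] := step _ Pp.
  pose a : R := i.+1%:R / i.+2%:R.
  have i2 : i.+2%:R != 0 :> R by rewrite pnatr_eq0.
  exists (a *: c + (1 - a) *: c'), p'; split=> //.
    apply: Cc => //; first by rewrite divr_ge0.
    by rewrite ler_pdivrMr ?ltr0n// mul1r ler_nat.
  have -> : 1 - a = i.+2%:R^-1.
    by rewrite /a -[i.+2]addn1 natrD in i2 *; field.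
  rewrite scalerDr !scalerA /a mulrCA mulfV// mulr1 scale1r.
  rewrite -addrA -yc' addrCA -yc.
  by rewrite addrA -[i.+2]addn1 natrD scalerDl scale1r [y + _]addrC.
pose i := Num.bound (2 * b / eps).
have [c [p [Cc' Pp yc]]] := avg i; exists c => //.
have b0 : 0 <= b by apply: le_trans (Pb _ Pp).
have i1 : 0 < i.+1%:R :> R by rewrite ltr0n.
have -> : y - c = i.+1%:R^-1 *: (p - p0).
  apply: (scalerI (lt0r_neq0 i1)); rewrite scalerA mulfV ?gt_eqF// scale1r.
  by rewrite scalerBr; apply/eqP; rewrite subr_eq addrAC -subr_eq opprK yc addrC.
rewrite normrZ normfV ger0_norm ?ler0n// ler_pdivrMl//.
rewrite (@le_trans _ _ (2 * b))//.
  by rewrite (le_trans (ler_normB _ _))// mulr_natl mulr2n lerD ?Pb.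
rewrite -ler_pdivrMr//; apply: le_trans (_ : i%:R <= _); last by rewrite ler_nat.
by rewrite ltW// archi_boundP// divr_ge0 ?mulr_ge0// ltW.
Qed.

(** * Safe trajectories and the outer set *)

Section Outer.
Variables (R : realType) (n m d : nat) (A : 'M[R]_n) (B : 'M[R]_(n, m)).
Variables (E : 'M[R]_(n, d)) (W : set 'cV[R]_d) (S : set 'cV[R]_(n + m)).
Variable nu : nat.
Hypotheses (A_nilp : A ^+ nu = 0) (W0 : W 0).

Lemma safe_in_C_outer x (u : nat -> 'cV[R]_m) :
  (forall t, pair_set (reach A B E W t x u) (u t) `<=` S) ->
  C_outer A B E W S nu x.
Proof.
move=> Su; exists u; split=> [t _|]; first exact: Su.
rewrite /reach -traj_sum => _ [_ -> [w Ww <-]].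
exists (traj A B x u nu); last by exists w.
apply: (CISmax_largest (traj_tail_CIS (nu := nu) (x := x) (u := u) _)).
  move=> t nut; apply/SbarP; rewrite -(Wbar_stable A_nilp E W0 nut).
  exact/pair_reach_subP.
by exists nu => /=.
Qed.

(** The state reached at time [nu] is only in the closure of [CISmax], so from
    then on a trajectory issued from a nearby point [c0] of [CISmax] is
    followed.  The two trajectories then differ by [A ^+ (t - nu) *m (y - c0)],
    which is small uniformly in [t]. *)
Lemma C_outer_continuation x (eps : R) :
  convex_set (S : set (convex_lmodType 'cV[R]_(n + m))) -> bounded_set W ->
  C_outer A B E W S nu x -> 0 < eps ->
  exists (u : nat -> 'cV[R]_m) (c : nat -> 'cV[R]_n),
    (forall t w, Wbar A E W t w -> S (col_mx (c t + w) (u t))) /\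
    (forall t, `|traj A B x u t - c t| <= eps).
Proof.
move=> Sc Wb [u [Su]]; rewrite /reach -traj_sum => Ru eps0.
set y := traj A B x u nu in Ru.
have K0 : 0 < nilp_gain A nu + 1 by rewrite ltr_wpDl ?nilp_gain_ge0.
have [c0 Cc0 yc0] := mink_sum_cancel_closure
  (CISmax_convex (mink_diff_convex Sc)) (Wbar_bounded A E nu Wb)
  (Wbar_zero A E nu W0) Ru (divr_gt0 eps0 K0).
have [v Sv] := CIS_traj (@CISmax_is_CIS _ _ _ _ _ _) Cc0.
pose u' t := if (t < nu)%N then u t else v (t - nu)%N.
have traj_u' t : (t <= nu)%N -> traj A B x u' t = traj A B x u t.
  by move=> tnu; apply: traj_ext => s st; rewrite /u' (leq_trans st).
exists u', (fun t => if (t < nu)%N then traj A B x u t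
                     else traj A B c0 v (t - nu)%N).
split=> t => [w Ww|]; [rewrite /u'|]; case: ltnP => [tnu|nut].
- by have /pair_reach_subP := Su _ tnu; apply.
- by have /SbarP := Sv (t - nu)%N; apply; exact: Wbar_sub Ww.
- by rewrite (traj_u' _ (ltnW tnu)) subrr normr0 ltW.
have -> : traj A B x u' t - traj A B c0 v (t - nu)%N =
    A ^+ (t - nu) *m (y - c0).
  rewrite -{1}(subnK nut); elim: (t - nu)%N => {t nut} [|k IH].
    by rewrite expr0 mul1mx /= traj_u'.
  rewrite exprS -[A * _]/(A *m _) -mulmxA -IH /= /u' ltnNge leq_addl /= addnK.
  by rewrite mulmxBr opprD addrACA subrr addr0.
rewrite (le_trans (norm_expr_le_gain A_nilp _ _))//.
rewrite (le_trans (ler_wpM2l (nilp_gain_ge0 A nu) yc0))//.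
by rewrite mulrCA ger_pMr// ler_pdivrMr// mul1r lerDl.
Qed.

End Outer.

(** * Pulling a trajectory toward the fixed point *)

Section Blend.
Variables (R : realType) (n m d : nat) (A : 'M[R]_n) (B : 'M[R]_(n, m)).
Variables (E : 'M[R]_(n, d)) (W : set 'cV[R]_d) (S : set 'cV[R]_(n + m)).
Variable nu : nat.
Hypotheses (A_nilp : A ^+ nu = 0) (W0 : W 0).
Hypothesis Sc : convex_set (S : set (convex_lmodType 'cV[R]_(n + m))).
Variables (xf : 'cV[R]_n) (uf : 'cV[R]_m) (eps : R).
Hypotheses (eps0 : 0 < eps) (fixed : A *m xf + B *m uf = xf).
Hypothesis safe_ball :
  forall e, `|e| < eps -> Sbar A E W S nu (col_mx (xf + e) uf).
Variables (b rho : R) (tau : nat).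
Hypotheses (b0 : 0 <= b) (rho0 : 0 < rho) (rho1 : rho < 1).
Hypothesis slow : (1 - rho) * (nilp_gain A nu * b) <= eps / 4.
Variables (x : 'cV[R]_n) (u : nat -> 'cV[R]_m) (c : nat -> 'cV[R]_n).
Hypothesis c_safe : forall t w, Wbar A E W t w -> S (col_mx (c t + w) (u t)).
Hypothesis c_close : forall t, `|traj A B x u t - c t| <= rho ^+ tau * (eps / 4).
Hypothesis traj_bnd : forall t, `|traj A B x u t - xf| <= b.

(** Truncated subtraction makes the weight equal to [1] from [tau] on. *)
Definition pull (t : nat) : R := rho ^+ (tau - t).
Definition blend_state : 'cV[R]_n := xf + (1 - pull 0) *: (x - xf).
Definition blend_input (t : nat) : 'cV[R]_m := uf + (1 - pull t) *: (u t - uf).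

Lemma pull_gt0 t : 0 < pull t. Proof. exact: exprn_gt0. Qed.

Lemma pull_le1 t : pull t <= 1.
Proof. by rewrite exprn_ile1// ltW. Qed.

Lemma pull_mono s t : (s <= t)%N -> pull s <= pull t.
Proof.
by move=> st; apply: ler_wiXn2l; rewrite ?ltW// leq_sub2l.
Qed.

Lemma pull_step s t : (s < t)%N ->
  `|pull s.+1 - pull s| <= (1 - rho) * pull t.
Proof.
move=> st; have [taus|taus] := leqP tau s.
  rewrite /pull (eqP taus) (eqP (leqW taus)) subrr normr0.
  by rewrite mulr_ge0 ?exprn_ge0 ?subr_ge0// ltW.
have -> : pull s = rho * pull s.+1 by rewrite /pull -exprS; congr (_ ^+ _); lia.
rewrite -[X in X - _]mul1r -mulrBl normrM ger0_norm ?subr_ge0; last exact: ltW.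
rewrite ler_wpM2l ?subr_ge0//; first exact: ltW.
by rewrite ger0_norm ?pull_mono// ltW// pull_gt0.
Qed.

(** What is lost with respect to the convex combination, with weight [pull t],
    of the nominal state and the fixed point. *)
Definition blend_error (t : nat) : 'cV[R]_n :=
  traj A B blend_state blend_input t - xf - (1 - pull t) *: (traj A B x u t - xf).

(** The fixed point equation cancels everything but the increment of the
    weight, which multiplies a bounded vector. *)
Lemma blend_errorS t :
  blend_error t.+1 = A *m blend_error t +
    (pull t.+1 - pull t) *: (traj A B x u t.+1 - xf).
Proof.
rewrite /blend_error /= /blend_input.
have Buf : B *m uf = xf - A *m xf
  by apply/eqP; rewrite eq_sym subr_eq addrC fixed.
rewrite !(mulmxDr, mulmxBr, mulmxN, =^~ scalemxAr) Buf.
move: (A *m traj _ _ _ _ _) (A *m xf) (A *m traj _ _ _ _ _) (B *m _).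
move=> X' Axf X Bu; apply/colP => i; rewrite !mxE; ring.
Qed.

Lemma blend_error_le t : `|blend_error t| <= pull t * (eps / 4).
Proof.
apply: (@le_trans _ _ (nilp_gain A nu * ((1 - rho) * pull t * b))).
  apply: (nilp_recurrence_le A_nilp _ blend_errorS).
  - by rewrite /blend_error /= /blend_state [xf + _]addrC addrK subrr.
  - by rewrite !mulr_ge0// ?subr_ge0 ltW// pull_gt0.
  - by move=> s st; rewrite normrZ ler_pM// pull_step.
have -> : nilp_gain A nu * ((1 - rho) * pull t * b) =
  pull t * ((1 - rho) * (nilp_gain A nu * b)) by ring.
by rewrite ler_pM2l// pull_gt0.
Qed.

(** The blended pair is the convex combination of the safe pair [(c t, u t)]
    and of [(xf + e, uf)], where [e] collects the error of the blending and the
    distance from the trajectory to [c], both divided by the weight [pull t] of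
    the fixed point.  Each of the two contributes at most [eps / 4] to [e]. *)
Lemma blend_safe t w :
  Wbar A E W t w ->
  S (col_mx (traj A B blend_state blend_input t + w) (blend_input t)).
Proof.
move=> Ww; have p0 := pull_gt0 t; have p1 := pull_le1 t.
pose e := (pull t)^-1 *: (blend_error t + (1 - pull t) *: (traj A B x u t - c t)).
have e_lt : `|e| < eps.
  rewrite normrZ normfV gtr0_norm// mulrC ltr_pdivrMr//.
  rewrite (le_lt_trans (ler_normD _ _))// normrZ ger0_norm ?subr_ge0//.
  have := blend_error_le t.
  have : (1 - pull t) * `|traj A B x u t - c t| <= pull t * (eps / 4).
    apply: (@le_trans _ _ `|traj A B x u t - c t|).
      by rewrite ler_piMl// gerBl ltW.
    apply: le_trans (c_close t) _; apply: ler_wpM2r.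
      by rewrite divr_ge0// ltW.
    by apply: ler_wiXn2l; rewrite ?leq_subr// ltW.
  have : 0 < pull t * eps by rewrite mulr_gt0.
  lra.
have := safe_ball e_lt => /SbarP/(_ _ (Wbar_sub A_nilp W0 Ww)) Se.
have -> : col_mx (traj A B blend_state blend_input t + w) (blend_input t) =
    (1 - pull t) *: col_mx (c t + w) (u t) +
    (1 - (1 - pull t)) *: col_mx (xf + e + w) uf.
  rewrite !scale_col_mx add_col_mx subKr; congr col_mx; last first.
    by apply/colP => i; rewrite /blend_input !mxE; ring.
  apply/colP => i; rewrite /e /blend_error !mxE; field.
  exact: lt0r_neq0.
move/convex_setP : Sc; apply=> //; last exact: c_safe.
  by rewrite subr_ge0.
by rewrite gerBl ltW.
Qed.

Lemma blend_dist : x - blend_state = rho ^+ tau *: (x - xf).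
Proof.
by rewrite /blend_state /pull subn0; apply/colP => i; rewrite !mxE; ring.
Qed.

Lemma blend_input_tail t : (tau <= t)%N -> blend_input t = uf.
Proof.
by rewrite /blend_input /pull => /eqP->; rewrite subrr scale0r addr0.
Qed.

End Blend.

(** * Input sequences generated by the lasso matrices *)

Section Lasso.
Variables (R : realType) (m tau lambda : nat).
Hypothesis lambda0 : (0 < lambda)%N.
Implicit Type u : nat -> 'cV[R]_m.

Definition lasso_code u : 'cV[R]_(\sum_(i < m) (tau + lambda)) :=
  \mxcol_(i < m) \col_(j < tau + lambda) u j i 0.

(** The last row of each block reads [u tau] where the shifted sequence needs
    [u (tau + lambda)]. *)
Lemma lasso_P_code u :
  u (tau + lambda)%N = u tau ->
  lasso_P R m tau lambda *m lasso_code u = lasso_code (fun t => u t.+1).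
Proof.
move=> u_per; rewrite mul_mxdiag_mxcol; apply: eq_mxcol => i.
apply/colP => k; rewrite !mxE.
have [kq|kq] := eqVneq k.+1 (tau + lambda)%N.
  rewrite [in RHS]kq u_per.
  have tauq : (tau < tau + lambda)%N by rewrite -[ltnLHS]addn0 ltn_add2l.
  rewrite (bigD1 (Ordinal tauq))//= !mxE kq !eqxx mul1r big1 ?addr0// => j jtau.
  rewrite !mxE kq eqxx; case: eqVneq => [jE|]; last by rewrite mul0r.
  by case/eqP: jtau; apply: val_inj.
have kq' : (k.+1 < tau + lambda)%N by rewrite ltn_neqAle kq ltn_ord.
rewrite (bigD1 (Ordinal kq'))//= !mxE (negbTE kq) eqxx mul1r big1 ?addr0//.
move=> j jk; rewrite !mxE (negbTE kq); case: eqVneq => [jE|]; last by rewrite mul0r.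
by case/eqP: jk; apply: val_inj.
Qed.

Lemma lasso_H_code u : lasso_H R m tau lambda *m lasso_code u = u 0%N.
Proof.
have q0 : (0 < tau + lambda)%N by rewrite addn_gt0 lambda0 orbT.
rewrite mul_mxrow_mxcol; apply/colP => k.
rewrite summxE (bigD1 k)//= big1 ?addr0 => [|i ik].
  rewrite -mulmxA mxE big_ord1 !mxE !eqxx mul1r.
  rewrite (bigD1 (Ordinal q0))//= !mxE mul1r big1 ?addr0// => j j0.
  rewrite !mxE; case: eqVneq => [jE|]; last by rewrite mul0r.
  by case/eqP: j0; apply: val_inj.
by rewrite -mulmxA mxE big_ord1 !mxE eq_sym (negbTE ik) mul0r.
Qed.

Lemma lasso_realizes u :
  (forall t, (tau <= t)%N -> u (t + lambda)%N = u t) ->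
  forall t, lasso_H R m tau lambda *m
    (lasso_P R m tau lambda ^+ t *m lasso_code u) = u t.
Proof.
move=> u_per t.
suff -> : lasso_P R m tau lambda ^+ t *m lasso_code u =
    lasso_code (fun s => u (s + t)%N) by rewrite lasso_H_code.
elim: t => [|t IH].
  by rewrite expr0 mul1mx; congr lasso_code; apply/funext => s; rewrite addn0.
rewrite exprS -[_ * _]/(_ *m _) -mulmxA IH lasso_P_code.
  by congr lasso_code; apply/funext => s; rewrite addSnnS.
by rewrite addnAC u_per// leq_addr.
Qed.

End Lasso.

(** * Rate of convergence *)

Lemma hausdorff_excess_le (R : realType) (k : nat) (P Q : set 'cV[R]_k)
    (b : R) :
  (forall x, P x -> exists2 y, Q y & enorm (x - y) <= b) ->
  (hausdorff_excess P Q <= b%:E)%E.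
Proof.
move=> PQ; apply: ge_ereal_sup => _ [x /PQ[y Qy xy] <-].
apply: (@le_trans _ _ (enorm (x - y))%:E); last by rewrite lee_fin.
by apply: ereal_inf_lbound; exists y.
Qed.

Lemma interior_col_mx_ball (R : realType) (n m : nat)
    (T : set 'cV[R]_(n + m)) (x : 'cV[R]_n) (u : 'cV[R]_m) :
  interior T (col_mx x u) ->
  exists2 eps, 0 < eps & forall e, `|e| < eps -> T (col_mx (x + e) u).
Proof.
move=> /nbhs_ballP[eps eps0 epsT]; exists eps => // e e_lt; apply: epsT.
rewrite mx_norm_ball /ball_ /= opp_col_mx add_col_mx subrr opprD addNKr.
rewrite (le_lt_trans _ e_lt)//; apply: mx_norm_le => // i j.
rewrite mxE; case: (fintype.split i) => k; last by rewrite mxE normr0.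
by rewrite mxE normrN mx_norm_entry.
Qed.

Section Convergence.
Variables (R : realType) (n m d : nat) (A : 'M[R]_n) (B : 'M[R]_(n, m)).
Variables (E : 'M[R]_(n, d)) (W : set 'cV[R]_d) (S : set 'cV[R]_(n + m)).
Variable nu : nat.
Hypotheses (A_nilp : A ^+ nu = 0) (W0 : W 0) (W_bnd : bounded_set W).
Hypothesis (S_bnd : bounded_set S).
Hypothesis Sc : convex_set (S : set (convex_lmodType 'cV[R]_(n + m))).
Hypothesis fixed_pt : exists (x : 'cV[R]_n) (u : 'cV[R]_m),
  interior (Sbar A E W S nu) (col_mx x u) /\ A *m x + B *m u = x.

(** All constants come from the bounds on [S] and from the ball around the fixed
    point, so they are the same for all [tau] and [x]. *)
Lemma C_outer_approx :
  exists (c a : R), [/\ 0 < c, 0 < a, a < 1 &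
    forall tau x, C_outer A B E W S nu x ->
    exists (x' : 'cV[R]_n) (u : nat -> 'cV[R]_m) (v : 'cV[R]_m),
      [/\ forall t, pair_set (reach A B E W t x' u) (u t) `<=` S,
          forall t, (tau <= t)%N -> u t = v
        & enorm (x - x') <= c * a ^+ tau]].
Proof.
have [xf [uf [/interior_col_mx_ball[eps eps0 safe_ball] fixed]]] := fixed_pt.
have /bounded_setP[s Sb] := S_bnd.
pose b := `|s| + `|xf| + eps.
have b0 : 0 <= b by rewrite !addr_ge0// ltW.
have Kb0 : 0 <= nilp_gain A nu * b by rewrite mulr_ge0// nilp_gain_ge0.
(* Chosen so that [slow] below holds; [eps] is added to the denominator so that
   [0 < eta < 1] even if the gain is 0. *)
pose eta := eps / 4 / (nilp_gain A nu * b + eps).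
have den0 : 0 < nilp_gain A nu * b + eps by rewrite ltr_wpDl.
have eta0 : 0 < eta by rewrite divr_gt0// divr_gt0.
have eta1 : eta < 1 by rewrite ltr_pdivrMr// mul1r; lra.
have slow : (1 - (1 - eta)) * (nilp_gain A nu * b) <= eps / 4.
  rewrite subKr /eta mulrAC ler_pdivrMr// ler_wpM2l ?divr_ge0// ?ltW//.
  by rewrite ltrDl.
exists (Num.sqrt n%:R * b + 1), (1 - eta); split=> [|||tau x Cx].
- by rewrite ltr_wpDl// mulr_ge0// sqrtr_ge0.
- by rewrite subr_gt0.
- by rewrite gtrBl.
have rho0 : 0 < 1 - eta by rewrite subr_gt0.
have rho1 : 1 - eta < 1 by rewrite gtrBl.
have [u [c [c_safe c_close]]] := C_outer_continuation A_nilp W0 Sc W_bnd Cx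
  (mulr_gt0 (exprn_gt0 tau rho0) (divr_gt0 eps0 (ltr0n R 4))).
have traj_bnd t : `|traj A B x u t - xf| <= b.
  have cb : `|c t| <= `|s|.
    apply: mx_norm_le => // i j; rewrite (le_trans _ (ler_norm s))//.
    have := c_safe t 0 (Wbar_zero A E t W0); rewrite addr0 => /Sb.
    apply: le_trans; rewrite -(col_mxEu _ (u t)); exact: mx_norm_entry.
  have close : `|traj A B x u t - c t| <= eps.
    apply: le_trans (c_close t) _.
    have : (1 - eta) ^+ tau <= 1 by rewrite exprn_ile1 ?ltW.
    by nra.
  rewrite -[traj _ _ _ _ _](subrK (c t)) -addrA (le_trans (ler_normD _ _))//.
  have := ler_normB (c t) xf; rewrite /b; lra.
exists (blend_state xf (1 - eta) tau x), (blend_input uf (1 - eta) tau u), uf.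
split=> [t|t|].
- apply/pair_reach_subP => w.
  exact: (blend_safe A_nilp W0 Sc eps0 fixed safe_ball b0 rho0 rho1 slow
    c_safe c_close traj_bnd).
- exact: blend_input_tail.
have a0 : 0 <= (1 - eta) ^+ tau by rewrite exprn_ge0// ltW.
rewrite blend_dist enormZ// mulrC ler_wpM2r//.
apply: le_trans (enorm_le _) _.
by rewrite ler_wpDr// ler_wpM2l ?sqrtr_ge0// (traj_bnd 0%N).
Qed.

Lemma lasso_hausdorff_le :
  exists (c a : R), [/\ 0 < c, 0 < a, a < 1 &
    forall lambda tau, (0 < lambda)%N ->
      (hausdorff_dist
         (proj_fst (C_xv A B E W S (lasso_H R m tau lambda)
                                 (lasso_P R m tau lambda)))
         (C_outer A B E W S nu) <= (c * a ^+ tau)%:E)%E].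
Proof.
have [c [a [c0 a0 a1 approx]]] := C_outer_approx.
exists c, a; split=> // lambda tau lambda0.
rewrite /hausdorff_dist ge_max; apply/andP; split.
  apply: hausdorff_excess_le => _ [z /= Cz <-]; exists (usubmx z).
    exact: (safe_in_C_outer A_nilp W0 Cz).
  rewrite subrr -[0](scale0r (0 : 'cV[R]_n)) enormZ// mul0r.
  by rewrite mulr_ge0 ?exprn_ge0 ?ltW.
apply: hausdorff_excess_le => x /(approx tau)[x' [u [v [Su uv xx']]]].
exists x' => //; exists (col_mx x' (lasso_code tau lambda u)); last first.
  by rewrite col_mxKu.
rewrite /C_xv /= col_mxKu col_mxKd.
have uE t : lasso_H R m tau lambda *m
    (lasso_P R m tau lambda ^+ t *m lasso_code tau lambda u) = u t.
  apply: lasso_realizes => // s taus.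
  by rewrite !uv// (leq_trans taus)// leq_addr.
by rewrite (funext uE) => t; rewrite uE; exact: Su.
Qed.

End Convergence.

Theorem theorem6p6 (R : realType) (n m d : nat)
    (A : 'M[R]_n) (B : 'M[R]_(n, m)) (E : 'M[R]_(n, d)) (nu : nat)
    (Sxu : set 'cV[R]_(n + m)) (W : set 'cV[R]_d)
    (A_nilp : nilpotency_index A nu)
    (S_poly : polytope Sxu) (W_poly : polytope W)
    (W0 : W 0)
    (fixed_pt : exists (x : 'cV[R]_n) (u : 'cV[R]_m),
       interior (Sbar A E W Sxu nu) (col_mx x u) /\ A *m x + B *m u = x) :
  (forall eps : R, 0 < eps ->
     exists (p : nat) (H : 'M[R]_(m, p)) (P : 'M[R]_p),
       (hausdorff_dist (proj_fst (C_xv A B E W Sxu H P))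
                       (C_outer A B E W Sxu nu) <= eps%:E)%E) /\
  (forall lambda : nat, (0 < lambda)%N ->
     exists (c a : R) (tau0 : nat),
       [/\ 0 < c, 0 < a, a < 1 &
        forall tau : nat, (tau0 <= tau)%N ->
          (hausdorff_dist
             (proj_fst (C_xv A B E W Sxu (lasso_H R m tau lambda)
                                     (lasso_P R m tau lambda)))
             (C_outer A B E W Sxu nu) <= (c * a ^+ tau)%:E)%E]).
Proof.
have [nu0 A_nu _] := A_nilp.
have [c [a [c0 a0 a1 rate]]] := lasso_hausdorff_le A_nu W0 W_poly.1 S_poly.1
  (polytope_convex S_poly) fixed_pt.
split=> [eps eps0|lambda lambda0]; last first.
  by exists c, a, 0%N; split=> // tau _; exact: rate.
have a_norm : `|a| < 1 by rewrite gtr0_norm.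
have /cvgr0_norm_lt/(_ _ (divr_gt0 eps0 c0))[N _ aN] := cvg_expr a_norm.
exists _, (lasso_H R m N 1), (lasso_P R m N 1).
apply: le_trans (rate _ _ _) _ => //; rewrite lee_fin.
have := aN N (leqnn N); rewrite /= gtr0_norm ?exprn_gt0//.
by rewrite ltr_pdivlMr// mulrC => /ltW.
Qed.
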